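(* Let $X$ be a connected $1$-dimensional simplicial complex with simplicial metric $d$, let $P$ be a family of paths in $X$ which is almost transitive with constant $A\ge0$, and let $\pi_p:X^{(0)}\to[I_p,\dots,J_p]$ ($p\in P$) be a family of projection maps such that the Coarse Retract, Coarse Lipschitz and Strong Contraction Axioms hold with constants $a,b,c>0$. Then there exist constants $K,C\ge0$ depending only on $a,b,c$ and $A$ such that for each $p\in P$ and each $x\in X^{(0)}$, if $M\in[I_p,\dots,J_p]$ is chosen so that $D=d(x,p(M))$ minimizes $d(x,p(\ell))$ over all $\ell\in[I_p,\dots,J_p]$, then $$\mathrm{diam}\bigl(p[\pi_p(x),\dots,M]\bigr)\le K\log(\max\{D,1\})+C.$$
   Context: For integers $I\le J$ write $[I,\dots,J]=[J,\dots,I]=\{j\in\mathbb Z: I\le j\le J\}$; $X^{(0)}$ is the vertex set; the simplicial metric gives each edge length 1; $p[\ell,\dots,m]$ denotes the image under $p$ of $[\ell,\dots,m]$. Each $p\in P$ is a function $p:[I_p,\dots,J_p]\to X^{(0)}$ with $I_p<J_p$. Almost transitivity with constant $A$: $d(p(\ell-1),p(\ell))\le A$ whenever $p\in P$ and $I_p<\ell\le J_p$, and for all $x,y\in X^{(0)}$ there is $p\in P$ with $d(x,p(I_p))\le A$ and $d(p(J_p),y)\le A$. The axioms, for every $p\in P$: Coarse Retract Axiom: for each $\ell\in[I_p,\dots,J_p]$ the diameter of $p[\ell,\dots,\pi_p(p(\ell))]$ is at most $c$. Coarse Lipschitz Axiom: for all $x,y\in X^{(0)}$ with $d(x,y)\le1$,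 the diameter of $p[\pi_p(x),\dots,\pi_p(y)]$ is at most $c$. Strong Contraction Axiom: for all $x,y\in X^{(0)}$, if $d(x,p(\pi_p(x)))\ge a$ and $d(x,y)\le b\,d(x,p(\pi_p(x)))$, then the diameter of $p[\pi_p(x),\dots,\pi_p(y)]$ is at most $c$. *)

(* Defs.v *)
From mathcomp Require Import all_boot all_order all_algebra.
From mathcomp Require Import boolp classical_sets reals ereal exp.

Set Implicit Arguments.
Unset Strict Implicit.
Unset Printing Implicit Defensive.

Import Order.TTheory GRing.Theory Num.Theory.

Local Open Scope classical_set_scope.
Local Open Scope ring_scope.

(* A simplicial complex of dimension one is determined by its vertices and by
   which pairs of distinct vertices span an edge: a simplicial edge is not a
   loop, and two vertices span at most one. Only distances between vertices
   occur, so no geometric realization is built. *)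
Record complex1 := Complex1 {
  vertex :> Type;
  edge : rel vertex;
  edge_sym : symmetric edge;
  edge_irrefl : irreflexive edge;
  edge_exists : exists x y, edge x y }.

(* The vertices visited after x by the edge paths from x to y, so that the size
   of such a sequence is the length of the edge path. *)
Definition edge_paths (X : complex1) (x y : X) : set (seq X) :=
  [set s | path (@edge X) x s /\ last x s = y].

Definition edge_connected (X : complex1) : Prop :=
  forall x y : X, edge_paths x y !=set0.

(* Meaningful when X is connected: the infimum of the empty set is 0. *)
Definition sdist (R : realType) (X : complex1) (x y : X) : R :=
  inf [set (size s)%:R | s in edge_paths x y].

Definition diam (R : realType) (X : complex1) (S : set X) : \bar R :=
  ereal_sup [set (sdist R x y)%:E | x in S & y in S].

(* The integers between i and j, in whichever order i and j come. *)
Definition segment (i j : int) : set int :=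
  [set l | Num.min i j <= l <= Num.max i j].

(* The values of pmap outside [pstart, pend] are irrelevant. *)
Record ipath (X : complex1) := IPath {
  pstart : int;
  pend : int;
  pstart_lt_pend : pstart < pend;
  pmap :> int -> X }.

Definition pdom (X : complex1) (p : ipath X) : set int :=
  segment (pstart p) (pend p).

Definition almost_transitive (R : realType) (X : complex1) (T : Type)
    (P : T -> ipath X) (A : R) : Prop :=
  (forall (t : T) (l : int), pstart (P t) < l <= pend (P t) ->
     sdist R (P t (l - 1)) (P t l) <= A) /\
  (forall x y : X, exists t : T,
     sdist R x (P t (pstart (P t))) <= A /\
     sdist R (P t (pend (P t))) y <= A).

Definition projection_maps (X : complex1) (T : Type)
    (P : T -> ipath X) (pi : T -> X -> int) : Prop :=
  forall (t : T) (x : X), pdom (P t) (pi t x).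

Definition coarse_retract (R : realType) (X : complex1) (T : Type)
    (P : T -> ipath X) (pi : T -> X -> int) (c : R) : Prop :=
  forall (t : T) (l : int), pdom (P t) l ->
    (diam R (P t @` segment l (pi t (P t l))) <= c%:E)%E.

Definition coarse_lipschitz (R : realType) (X : complex1) (T : Type)
    (P : T -> ipath X) (pi : T -> X -> int) (c : R) : Prop :=
  forall (t : T) (x y : X), sdist R x y <= 1 ->
    (diam R (P t @` segment (pi t x) (pi t y)) <= c%:E)%E.

Definition strong_contraction (R : realType) (X : complex1) (T : Type)
    (P : T -> ipath X) (pi : T -> X -> int) (a b c : R) : Prop :=
  forall (t : T) (x y : X),
    a <= sdist R x (P t (pi t x)) ->
    sdist R x y <= b * sdist R x (P t (pi t x)) ->
    (diam R (P t @` segment (pi t x) (pi t y)) <= c%:E)%E.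

(* Main.v *)
(** Every vertex y on a geodesic from x to the nearest point p(M) also has p(M)
    as a nearest point, so d(y, p(pi y)) >= s := d(y, p(M)). As long as s is at
    least a and 1/b, strong contraction allows a jump along the geodesic that
    shrinks s by a definite factor while moving the projection by at most c;
    hence O(log D) jumps bring s below a fixed bound N. The remaining at most N
    edges are handled by the coarse Lipschitz axiom, and the endpoint p(M) by
    the coarse retract axiom. *)

Require Import Defs.
From mathcomp Require Import all_boot all_order all_algebra.
From mathcomp Require Import boolp classical_sets reals ereal exp.
From mathcomp Require Import zify ring lra.

Set Implicit Arguments.
Unset Strict Implicit.
Unset Printing Implicit Defensive.

Import Order.TTheory GRing.Theory Num.Theory.

Local Open Scope classical_set_scope.
Local Open Scope ring_scope.

Lemma sdist_le_size (R : realType) (X : complex1) (x y : X) (s : seq X) :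
  edge_paths x y s -> sdist R x y <= (size s)%:R.
Proof.
move=> xys; apply: ge_inf; last by exists s.
by exists 0 => _ [s' _ <-]; rewrite ler0n.
Qed.

(** Lengths of edge paths are natural numbers, so the infimum is a minimum. Hence distances are
    natural numbers and geodesics exist. *)
Lemma sdist_attained (R : realType) (X : complex1) (x y : X) :
  edge_connected X -> exists2 s, edge_paths x y s & sdist R x y = (size s)%:R.
Proof.
move=> cX.
have ex : exists n, `[< exists2 s, edge_paths x y s & size s = n >].
  by have [s xys] := cX x y; exists (size s); apply/asboolP; exists s.
case: (ex_minnP ex) => n /asboolP[s xys <-] nmin.
exists s => //; apply/eqP; rewrite eq_le sdist_le_size //=.
apply: lb_le_inf; first by exists (size s)%:R, s.
by move=> _ [s' xys' <-]; rewrite ler_nat; apply: nmin; apply/asboolP; exists s'.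
Qed.

Lemma sdist_triangle (R : realType) (X : complex1) (x y z : X) :
  edge_connected X -> sdist R x z <= sdist R x y + sdist R y z.
Proof.
move=> cX.
have [s [ps ls] ->] := sdist_attained R x y cX.
have [s' [ps' ls'] ->] := sdist_attained R y z cX.
rewrite -natrD -size_cat; apply: sdist_le_size; split.
  by rewrite cat_path ps ls.
by rewrite last_cat ls.
Qed.

Lemma sdist_ge0 (R : realType) (X : complex1) (x y : X) :
  edge_connected X -> 0 <= sdist R x y.
Proof. by move=> cX; have [s _ ->] := sdist_attained R x y cX. Qed.

Lemma sdist_eq0 (R : realType) (X : complex1) (x y : X) :
  edge_connected X -> sdist R x y = 0 -> x = y.
Proof.
move=> cX; have [s [_ <-] ->] := sdist_attained R x y cX.
by move=> /eqP; rewrite pnatr_eq0 => /eqP/size0nil ->.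
Qed.

(** Cut a shortest edge path after [k] edges: the pieces bound both distances from above, and the
    triangle inequality forces equality. *)
Lemma geodesic_point (R : realType) (X : complex1) (x y : X) (n k : nat) :
  edge_connected X -> sdist R x y = n%:R -> (k <= n)%N ->
  exists z, sdist R x z = k%:R /\ sdist R z y = (n - k)%:R.
Proof.
move=> cX xy kn; have [s [ps ls]] := sdist_attained R x y cX.
rewrite xy => /eqP; rewrite eqr_nat => /eqP sn; subst n.
exists (last x (take k s)).
have [pt pd] : path (@edge X) x (take k s) /\
    path (@edge X) (last x (take k s)) (drop k s).
  by apply/andP; rewrite -cat_path cat_take_drop.
have xz : sdist R x (last x (take k s)) <= k%:R.
  rewrite -[X in X%:R](size_takel kn).
  exact: sdist_le_size.
have zy : sdist R (last x (take k s)) y <= (size s - k)%:R.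
  by rewrite -size_drop; apply: sdist_le_size; split;
    rewrite // -last_cat cat_take_drop.
have := sdist_triangle R x (last x (take k s)) y cX.
by move: zy; rewrite xy natrB // => zy tri; split; lra.
Qed.

Lemma diam_leP (R : realType) (X : complex1) (S : set X) (r : R) :
  (diam R S <= r%:E)%E <-> forall x y, S x -> S y -> sdist R x y <= r.
Proof.
split=> [Sr x y Sx Sy|Sr].
  rewrite -lee_fin; apply: le_trans Sr; apply: ereal_sup_ubound.
  by exists x => //; exists y.
by apply: ge_ereal_sup => _ [x Sx [y Sy <-]]; rewrite lee_fin Sr.
Qed.

Lemma segment_sub_setU (i j k : int) :
  segment i k `<=` segment i j `|` segment j k.
Proof. by move=> l; rewrite /segment /=; lia. Qed.

(** Both images contain [f j], through which points of different images are compared. *)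
Lemma diam_segment_trans (R : realType) (X : complex1) (f : int -> X)
    (i j k : int) (r s : R) : edge_connected X ->
  (diam R (f @` segment i j) <= r%:E)%E ->
  (diam R (f @` segment j k) <= s%:E)%E ->
  (diam R (f @` segment i k) <= (r + s)%:E)%E.
Proof.
move=> cX /diam_leP ij /diam_leP jk; apply/diam_leP.
have jl : (f @` segment i j) (f j) by exists j => //; rewrite /segment /=; lia.
have jr : (f @` segment j k) (f j) by exists j => //; rewrite /segment /=; lia.
(* Nonnegativity serves the case of two points in the same image, where only one of the bounds [r],
   [s] is available. *)
have r0 := le_trans (sdist_ge0 R _ _ cX) (ij _ _ jl jl).
have s0 := le_trans (sdist_ge0 R _ _ cX) (jk _ _ jr jr).
move=> _ _ [u /(segment_sub_setU j) hu <-] [v /(segment_sub_setU j) hv <-].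
have := sdist_triangle R (f u) (f j) (f v) cX.
case: hu hv => [hu|hu] [hv|hv].
- have := ij (f u) (f v) (imageP f hu) (imageP f hv); lra.
- have := ij _ _ (imageP f hu) jl; have := jk _ _ jr (imageP f hv); lra.
- have := jk _ _ (imageP f hu) jr; have := ij _ _ jl (imageP f hv); lra.
- have := jk (f u) (f v) (imageP f hu) (imageP f hv); lra.
Qed.

Definition nearest (R : realType) (X : complex1) (p : ipath X) (x : X) (M : int) :=
  forall l, pdom p l -> sdist R x (p M) <= sdist R x (p l).

(** A point of the path closer to [z] than [p M] would also be closer to [x], by going through
    [z]. *)
Lemma nearest_geodesic (R : realType) (X : complex1) (p : ipath X) (x z : X)
    (M : int) :
  edge_connected X -> sdist R x z + sdist R z (p M) = sdist R x (p M) ->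
  nearest R p x M -> nearest R p z M.
Proof.
move=> cX xzM nx l /nx; have := sdist_triangle R x z (p l) cX; lra.
Qed.

(** Since ln(1 - q) <= -q, shrinking by the factor 1 - q lowers the logarithm by at least [q]. *)
Lemma ln_shrink (R : realType) (q m n : R) :
  0 < m -> m <= (1 - q) * n -> 0 < n -> ln m + q <= ln n.
Proof.
move=> m0 mn n0.
have q1 : 0 < 1 - q by rewrite -(pmulr_lgt0 _ n0); exact: lt_le_trans mn.
have : ln m <= ln ((1 - q) * n) by rewrite ler_ln ?posrE // mulr_gt0.
rewrite lnM ?posrE //.
have := @le_ln1Dx R (- q); lra.
Qed.

(** Take the integer part of q n. As it is at least 1, rounding down loses at most half of q n;
    [q <= 2^-1] keeps the jump short of the endpoint. *)
Lemma jump_length (R : realType) (q : R) (n : nat) :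
  0 < q -> q <= 2^-1 -> 1 <= q * n%:R ->
  exists k, [/\ (k < n)%N, k%:R <= q * n%:R & q / 2 * n%:R <= k%:R].
Proof.
move=> q0 q2 qn; exists (Num.truncn (q * n%:R)).
have /andP[] := truncn_itv (le_trans ler01 qn).
set k := Num.truncn _ => kl; rewrite -natr1 => ku.
have k0 : (0 < k)%N by rewrite lt0n; apply/negP => /eqP k0; rewrite k0 in ku; lra.
have k1 : 1 <= k%:R :> R by rewrite ler1n.
have n0 : 0 <= n%:R :> R by rewrite ler0n.
have n1 : (0 < n)%N by case: (n) qn => //; lra.
have n1' : 0 < n%:R :> R by rewrite ltr0n.
split => //; last lra.
rewrite -(ltr_nat R); nra.
Qed.

Section NearestPoint.
Variables (R : realType) (X : complex1) (T : Type).
Variables (P : T -> ipath X) (pi : T -> X -> int) (a b c : R).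
Hypothesis cX : edge_connected X.
Hypothesis piP : projection_maps P pi.
Hypothesis retr : coarse_retract P pi c.
Hypothesis lip : coarse_lipschitz P pi c.
Hypothesis contr : strong_contraction P pi a b c.
Hypothesis hc : 0 < c.
Variables (t : T) (M : int).
Hypothesis domM : pdom (P t) M.

(** Each of the [n] edges of a geodesic costs [c] by the Lipschitz axiom, and the endpoint costs one
    more [c] by the retract axiom. *)
Lemma diam_nearest_linear (n : nat) (x : X) :
  sdist R x (P t M) = n%:R ->
  (diam R (P t @` segment (pi t x) M) <= (c * n.+1%:R)%:E)%E.
Proof.
elim: n x => [|n IH] x xM.
  have -> := sdist_eq0 cX xM.
  rewrite /segment minC maxC mulr1; exact: retr.
have [z [xz]] := geodesic_point (k := 1) cX xM isT.
rewrite subn1 /= => /IH zM.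
rewrite -natr1 mulrDr mulr1 addrC; apply: diam_segment_trans zM => //.
by apply: lip; rewrite xz.
Qed.

Lemma diam_nearest_log (q : R) (N n : nat) (x : X) :
  0 < q -> q <= b -> q <= 2^-1 -> a <= N%:R -> 1 <= q * N%:R ->
  sdist R x (P t M) = n%:R -> nearest R (P t) x M ->
  (diam R (P t @` segment (pi t x) M) <=
     (2 * c / q * ln (Num.max n%:R 1) + c * N.+1%:R)%:E)%E.
Proof.
move=> q0 qb q2 aN qN.
elim/ltn_ind: n x => n IH x xM nx.
have K0 : 0 <= 2 * c / q by rewrite divr_ge0 ?mulr_ge0 ?ltW.
have [nN|Nn] := leqP n N.
  apply: le_trans (diam_nearest_linear xM) _; rewrite lee_fin.
  (* The maximum with 1 keeps the logarithmic term nonnegative. *)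
  rewrite -[leLHS]add0r; apply: lerD; last by rewrite ler_pM2l // ler_nat.
  by rewrite mulr_ge0 // ln_ge0 // le_max lexx orbT.
have Nn' : N%:R <= n%:R :> R by rewrite ler_nat ltnW.
have qn : 1 <= q * n%:R by nra.
have [k [kn kq qk]] := jump_length q0 q2 qn.
have [z [xz zM]] := geodesic_point cX xM (ltnW kn).
have k0 : (0 < k)%N by rewrite -(ltr_nat R); lra.
have nk : (n - k)%:R = n%:R - k%:R :> R by rewrite natrB // ltnW.
have nz : nearest R (P t) z M.
  by apply: nearest_geodesic nx => //; rewrite xM xz zM nk; lra.
have lt_nk : (n - k < n)%N by rewrite ltn_subrL k0 (leq_ltn_trans (leq0n k)).
have := IH _ lt_nk z zM nz.
(* This lower bound yields both premises of strong contraction: a <= N <= n, and k <= q n with q <=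
   b. *)
have n_le : n%:R <= sdist R x (P t (pi t x)) by rewrite -xM; exact/nx/piP.
have xz_c : (diam R (P t @` segment (pi t x) (pi t z)) <= c%:E)%E.
  by apply: contr; [lra | rewrite xz (le_trans kq) // ler_pM // ltW].
move=> /(diam_segment_trans cX xz_c) /le_trans; apply.
have m1 : 1 <= (n - k)%:R :> R by rewrite ler1n subn_gt0.
have n1 : 1 <= n%:R :> R by rewrite ler1n (leq_ltn_trans (leq0n k)).
rewrite lee_fin !max_l // addrA lerD2r.
(* The jump covers at least q n / 2, so the logarithm drops by q/2; times 2c/q this pays exactly the
   cost [c] of the jump. *)
have /(ler_wpM2l K0) : ln (n - k)%:R + q / 2 <= ln n%:R :> R.
  by apply: ln_shrink; rewrite ?nk; lra.
rewrite mulrDr [X in _ + X](_ : _ = c); first by rewrite addrC.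
by field; rewrite gt_eqF.
Qed.

End NearestPoint.

Theorem proposition5p6 (R : realType) (a b c A : R)
    (ha : 0 < a) (hb : 0 < b) (hc : 0 < c) (hA : 0 <= A) :
  exists K C : R, [/\ 0 <= K, 0 <= C &
    forall (X : complex1) (T : Type) (P : T -> ipath X) (pi : T -> X -> int),
      edge_connected X ->
      almost_transitive P A ->
      projection_maps P pi ->
      coarse_retract P pi c ->
      coarse_lipschitz P pi c ->
      strong_contraction P pi a b c ->
      forall (t : T) (x : X) (M : int),
        pdom (P t) M ->
        (forall l : int, pdom (P t) l ->
           sdist R x (P t M) <= sdist R x (P t l)) ->
        (diam R (P t @` segment (pi t x) M) <=
           (K * ln (Num.max (sdist R x (P t M)) 1) + C)%:E)%E].
Proof.
(* The bound by [b] makes jumps admissible for strong contraction, the bound by 1/2 makes them stop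
   before [p M]. *)
pose q := Num.min b 2^-1.
have q0 : 0 < q by rewrite lt_min hb invr_gt0 ltr0n.
(* A single threshold above both [a] and 1/q: beyond it contraction applies and jumps have length at
   least 1. *)
pose N := Num.bound (a + q^-1).
have q'0 : 0 < q^-1 by rewrite invr_gt0.
have aqN : a + q^-1 < N%:R.
  by apply: archi_boundP; rewrite addr_ge0 // ltW.
exists (2 * c / q), (c * N.+1%:R); split.
- by rewrite divr_ge0 ?mulr_ge0 // ltW.
- by rewrite mulr_ge0 // ltW.
move=> X T P pi cX _ piP retr lip contr t x M domM nx.
have [s _ xM] := sdist_attained R x (P t M) cX.
rewrite xM; apply: (diam_nearest_log cX piP retr lip contr hc domM) xM nx => //.
- by rewrite /q ge_min lexx.
- by rewrite /q ge_min lexx orbT.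
- lra.
- by rewrite mulrC -ler_pdivrMr // div1r; lra.
Qed.
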